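(* Let $t\ge 2$ be an integer, $\alpha=\big(2-t+\sqrt{t^2+4}\,\big)/2$, $A(n)=\lfloor n\alpha\rfloor$ for $n\ge1$, and let $\Delta AA$ be the infinite word $(A(A(n+1))-A(A(n)))_{n\ge 1}$. Then $\Delta AA$ is a morphic word; in fact $\Delta AA=\delta(x)$ where $x$ is a fixed point of a morphism $\tau$ on the alphabet $\{1,2,\dots,t+1\}$ and $\delta$ is a morphism on the same alphabet, given as follows. For $t=2$: $\tau(1)=12,\ \tau(2)=131,\ \tau(3)=121$; $\delta(1)=13,\ \delta(2)=222,\ \delta(3)=132$. For $t=3$: $\tau(1)=123,\ \tau(2)=124,\ \tau(3)=1141,\ \tau(4)=1241$; $\delta(1)=113,\ \delta(2)=122,\ \delta(3)=2122,\ \delta(4)=1222$. For $t\ge 4$ (writing $[t-j]$ for the letter $t-j$): $\tau(1)=1\,2\cdots[t-1]\,t$, $\tau(2)=1\,2\cdots[t-1]\,[t+1]$, for $j=3,\dots,t-1$: $\tau(j)=1\,2\cdots[t-j]\,[t-j+1]\,[t-j+1]\,[t-j+2]\cdots[t-2]\,[t+1]$, $\tau(t)=1\,1\,2\cdots[t-2]\,[t+1]\,1$, $\tau(t+1)=1\,2\,2\,3\cdots[t-2]\,[t+1]\,1$; and $\delta(1)=1^{t-1}3$, $\delta(2)=1^{t-2}22$, $\delta(j)=1^{t-j}\,2\,1^{j-2}\,2$ for $j=3,\dots,t-1$, $\delta(t)=2\,1^{t-2}\,22$, $\delta(t+1)=12\,1^{t-3}\,22$.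
   Context: A morphism on a finite alphabet maps each letter to a finite word and extends to words and infinite words by concatenation. A fixed point of $\tau$ is an infinite word $x$ with $\tau(x)=x$. A morphic word is the image under a letter-to-letter map of a fixed point of a morphism. Here $\Delta AA$ is regarded as an infinite word over the positive integers, and $\delta(x)$ denotes the concatenation $\delta(x_1)\delta(x_2)\cdots$ (a ''decoration'' of $x$). In the formulas, $1\,2\cdots k$ denotes the word of consecutive letters from $1$ to $k$, and $1^m$ denotes $m$ copies of the letter $1$. *)

(* Defs.v *)
From mathcomp Require Import all_boot all_order all_algebra.
From mathcomp Require Import reals.
From mathcomp Require Import lra.

Set Implicit Arguments.
Unset Strict Implicit.
Unset Printing Implicit Defensive.

Import Order.TTheory GRing.Theory Num.Theory.

Local Open Scope nat_scope.

(* Infinite words are functions on nat: [x n] is the (n+1)-st letter x_{n+1}. *)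

Definition ext (T U : Type) (phi : T -> seq U) (w : seq T) : seq U :=
  flatten (map phi w).

(* The infinite word y is the concatenation phi(x_1) phi(x_2) ... : the images
   of the finite prefixes of x are prefixes of y, of unbounded length.  For a
   given x there is at most one such y, and none if phi erases all but finitely
   many letters of x. *)
Definition is_image (T U : Type) (phi : T -> seq U) (x : nat -> T)
    (y : nat -> U) : Prop :=
  (forall n, let w := ext phi (mkseq x n) in w = mkseq y (size w)) /\
  (forall m, exists n, m <= size (ext phi (mkseq x n))).

Definition fixed_point (T : Type) (tau : T -> seq T) (x : nat -> T) : Prop :=
  is_image tau x x.

Definition prolongable (T : Type) (tau : T -> seq T) (a : T) : Prop :=
  exists2 u, tau a = a :: u & forall n, iter n (ext tau) u <> [::].

(* Prolongability at the first letter means that x is the limit of the words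
   tau^n(x_1).  Without it the notion would be void: every infinite word over a
   finite alphabet is a fixed point of the identity morphism. *)
Definition morphic (U : Type) (w : nat -> U) : Prop :=
  exists (B : finType) (tau : B -> seq B) (f : B -> U) (x : nat -> B),
    [/\ fixed_point tau x, prolongable tau (x 0) & forall n, w n = f (x n)].

Definition alphabet (t : nat) : pred nat := [pred j | 1 <= j <= t.+1].

Definition morphism_on (P : pred nat) (phi : nat -> seq nat) : Prop :=
  forall j, P j -> all P (phi j).

(* The word a (a+1) ... b, empty if b < a. *)
Definition consec (a b : nat) : seq nat := iota a (b.+1 - a).

(* The values of tau and delta outside alphabet t are irrelevant. *)

Definition tau2 (j : nat) : seq nat :=
  match j with
  | 1 => [:: 1; 2]
  | 2 => [:: 1; 3; 1]
  | 3 => [:: 1; 2; 1]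
  | _ => [::]
  end.

Definition delta2 (j : nat) : seq nat :=
  match j with
  | 1 => [:: 1; 3]
  | 2 => [:: 2; 2; 2]
  | 3 => [:: 1; 3; 2]
  | _ => [::]
  end.

Definition tau3 (j : nat) : seq nat :=
  match j with
  | 1 => [:: 1; 2; 3]
  | 2 => [:: 1; 2; 4]
  | 3 => [:: 1; 1; 4; 1]
  | 4 => [:: 1; 2; 4; 1]
  | _ => [::]
  end.

Definition delta3 (j : nat) : seq nat :=
  match j with
  | 1 => [:: 1; 1; 3]
  | 2 => [:: 1; 2; 2]
  | 3 => [:: 2; 1; 2; 2]
  | 4 => [:: 1; 2; 2; 2]
  | _ => [::]
  end.

Definition tau_ge4 (t j : nat) : seq nat :=
  if j == 1 then consec 1 t
  else if j == 2 then consec 1 (t - 1) ++ [:: t + 1]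
  else if 3 <= j <= t - 1 then
    consec 1 (t - j) ++ [:: t - j + 1] ++ consec (t - j + 1) (t - 2)
      ++ [:: t + 1]
  else if j == t then [:: 1] ++ consec 1 (t - 2) ++ [:: t + 1; 1]
  else if j == t + 1 then [:: 1; 2] ++ consec 2 (t - 2) ++ [:: t + 1; 1]
  else [::].

Definition delta_ge4 (t j : nat) : seq nat :=
  if j == 1 then nseq (t - 1) 1 ++ [:: 3]
  else if j == 2 then nseq (t - 2) 1 ++ [:: 2; 2]
  else if 3 <= j <= t - 1 then nseq (t - j) 1 ++ [:: 2] ++ nseq (j - 2) 1 ++ [:: 2]
  else if j == t then [:: 2] ++ nseq (t - 2) 1 ++ [:: 2; 2]
  else if j == t + 1 then [:: 1; 2] ++ nseq (t - 3) 1 ++ [:: 2; 2]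
  else [::].

Definition tau (t : nat) : nat -> seq nat :=
  if t == 2 then tau2 else if t == 3 then tau3 else tau_ge4 t.

Definition delta (t : nat) : nat -> seq nat :=
  if t == 2 then delta2 else if t == 3 then delta3 else delta_ge4 t.

Definition alpha (R : realType) (t : nat) : R :=
  ((2 - t%:R + Num.sqrt (t%:R ^+ 2 + 4)) / 2)%R.

(* Num.truncn is the floor with values in nat, for nonnegative arguments
   (lemma A_floor). *)
Definition A (R : realType) (t n : nat) : nat := Num.truncn (n%:R * alpha R t)%R.

(* The shift accounts for the indexing from 1: DeltaAA R t n is the (n+1)-st
   letter.  The truncated subtraction is exact since A is nondecreasing. *)
Definition DeltaAA (R : realType) (t n : nat) : nat :=
  A R t (A R t n.+2) - A R t (A R t n.+1).

Lemma alpha_ge0 (R : realType) (t : nat) : (0 <= alpha R t)%R.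
Proof.
have t0 : (0 <= t%:R :> R)%R by [].
have : (t%:R <= Num.sqrt (t%:R ^+ 2 + 4) :> R)%R.
  rewrite -[X in (X <= _)%R](ger0_norm t0) -sqrtr_sqr ler_wsqrtr ?lerDl //.
by rewrite /alpha; lra.
Qed.

Lemma A_floor (R : realType) (t n : nat) :
  Posz (A R t n) = Num.floor (n%:R * alpha R t)%R.
Proof.
have h : (0 <= n%:R * alpha R t)%R by rewrite mulr_ge0 ?alpha_ge0.
by rewrite /A truncn_floor h gez0_abs// floor_ge0.
Qed.

Lemma A_homo (R : realType) (t : nat) : {homo A R t : m n / m <= n}.
Proof.
by move=> m n mn; apply: le_truncn; rewrite ler_wpM2r ?alpha_ge0 ?ler_nat.
Qed.

(* Main.v *)
(* Put beta = alpha - 1, so that beta (t + beta) = 1, and for n >= 1 let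
   k_n = floor (n beta), f_n = {n beta} and g_n = ceil (f_n (t - 1 + beta)).
   Then A (A n) = 2 n + 2 k_n - t k_n - g_n.  The letter x_n is g_n, except that
   it is t + 1 when g_n = t - 1 and f_n > 1 - beta.  Cut the positive integers
   into blocks, the n-th one being t (n - 1) + k_n + 1, ..., t n + k_(n+1), of
   length t or t + 1.  At the i-th place m of the n-th block (0 <= i < t),
   k_m = n - 1 and g_m = i + [g_n <= t - i], while k = n and g = 1 just after
   these t places.  So g_n and the length of the block determine both the
   letters of x and those of Delta AA on it, and these are tau (x_n) and
   delta (x_n). *)

Require Import Defs.
From mathcomp Require Import all_boot all_order all_algebra.
From mathcomp Require Import reals.
From mathcomp Require Import zify ring lra.

Set Implicit Arguments.
Unset Strict Implicit.
Unset Printing Implicit Defensive.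
Import Order.TTheory GRing.Theory Num.Theory.
Local Open Scope nat_scope.

(** * Concatenations and morphic words *)

Lemma mkseq_add (T : Type) (f : nat -> T) (m n : nat) :
  mkseq f (m + n) = mkseq f m ++ mkseq (fun i => f (m + i)) n.
Proof.
by rewrite /mkseq iotaD map_cat add0n -[in iota m n](addn0 m) iotaDl -map_comp.
Qed.

Lemma ext_cat (T U : Type) (phi : T -> seq U) (v w : seq T) :
  ext phi (v ++ w) = ext phi v ++ ext phi w.
Proof. by rewrite /ext map_cat flatten_cat. Qed.

Lemma ext_mkseqS (T U : Type) (phi : T -> seq U) (x : nat -> T) (n : nat) :
  ext phi (mkseq x n.+1) = ext phi (mkseq x n) ++ phi (x n).
Proof. by rewrite mkseqS -cats1 ext_cat /ext /= cats0. Qed.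

Lemma size_gt0 (T : Type) (s : seq T) : s <> [::] -> 0 < size s.
Proof. by case: s. Qed.

(** Consecutive nonempty blocks tile y: the images of the first n letters fill exactly the first
    [pos n] places. Both the fixed point and the decoration are obtained this way. *)
Lemma is_image_blocks (T U : Type) (phi : T -> seq U) (x : nat -> T)
    (y : nat -> U) (pos : nat -> nat) :
  pos 0 = 0 ->
  (forall n, phi (x n) <> [::]) ->
  (forall n, phi (x n) = mkseq (fun i => y (pos n + i)) (size (phi (x n)))) ->
  (forall n, pos n.+1 = pos n + size (phi (x n))) ->
  is_image phi x y.
Proof.
move=> p0 pN pE pS.
have H n : ext phi (mkseq x n) = mkseq y (pos n).
  elim: n => [|n IH]; first by rewrite p0.
  by rewrite ext_mkseqS IH pS mkseq_add -pE.
split=> [n /=|m]; first by rewrite H size_mkseq.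
exists m; rewrite H size_mkseq; elim: m => // m IH.
by rewrite pS -addn1 leq_add // size_gt0.
Qed.

(** A prefix of a prefix is a prefix, so arbitrarily long ones suffice. In [morphic_image] only
    prefixes ending at a block boundary are under control. *)
Lemma is_image_cofinal (T U : Type) (phi : T -> seq U) (x : nat -> T)
    (y : nat -> U) :
  (forall m, exists n, [/\ m <= n, m <= size (ext phi (mkseq x n)) &
    ext phi (mkseq x n) = mkseq y (size (ext phi (mkseq x n)))]) ->
  is_image phi x y.
Proof.
move=> H; split=> [m /=|m]; last by have [n []] := H m; exists n.
have [n [mn _]] := H m; rewrite -(subnKC mn) mkseq_add ext_cat => /esym.
rewrite size_cat mkseq_add => /(congr1 (take (size (ext phi (mkseq x m))))).
by rewrite take_size_cat ?size_mkseq // take_size_cat.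
Qed.

Lemma is_image_exists (T U : Type) (phi : T -> seq U) (x : nat -> T) :
  (forall n, phi (x n) <> [::]) -> exists y, is_image phi x y.
Proof.
move=> pN.
have [d _] : exists d : U, True by case: (phi (x 0)) (pN 0) => // d; exists d.
pose pos n := size (ext phi (mkseq x n)).
have posS n : pos n.+1 = pos n + size (phi (x n)).
  by rewrite /pos ext_mkseqS size_cat.
have le n : n <= pos n.
  elim: n => // n IH; by rewrite posS -addn1 leq_add // size_gt0.
(* The image of m + 1 letters is longer than m because no letter is erased, so the default [d] is
   never reached. *)
exists (fun m => nth d (ext phi (mkseq x m.+1)) m).
have nthE n m i : n <= m -> i < pos n ->
    nth d (ext phi (mkseq x m)) i = nth d (ext phi (mkseq x n)) i.
  by move=> nm ip; rewrite -(subnKC nm) mkseq_add ext_cat nth_cat ip.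
have nthC n i : i < pos n ->
    nth d (ext phi (mkseq x n)) i = nth d (ext phi (mkseq x i.+1)) i.
  move=> ip; have [l|l] := leqP n i.+1; first by rewrite (nthE n i.+1).
  by apply: nthE; [apply: ltnW | apply: le].
apply: (@is_image_blocks _ _ _ _ _ pos) => // n.
apply: (@eq_from_nth _ d); first by rewrite size_mkseq.
move=> i il; rewrite nth_mkseq // -(nthC n.+1) ?posS ?ltn_add2l //.
by rewrite ext_mkseqS nth_cat -/(pos n) ltnNge leq_addr /= addKn.
Qed.

Lemma enum_ord_head (n : nat) (n0 : 0 < n) :
  exists2 r : seq 'I_n,
    enum 'I_n = Ordinal n0 :: r & all (fun i : 'I_n => 0 < i) r.
Proof.
case: n n0 => // n n0; rewrite enum_ordSl.
exists [seq lift ord0 i | i <- enum 'I_n]; first by congr cons; apply: val_inj.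
by rewrite all_map; apply/allP.
Qed.

(* Letters of the new alphabet are pairs (b, i) marking the i-th letter of dl b.
   Its morphism erases: all of mu b is carried by (b, 0). *)
Lemma morphic_image (B : finType) (U : Type) (mu : B -> seq B)
    (dl : B -> seq U) (x : nat -> B) (w : nat -> U) :
  fixed_point mu x -> prolongable mu (x 0) -> (forall b, dl b <> [::]) ->
  is_image dl x w -> morphic w.
Proof.
move=> [fx fx_unb] [v muv vN] dN [dw dl_unb].
have dl0 b : 0 < size (dl b) by exact: size_gt0.
pose tg b (i : 'I_(size (dl b))) := Tagged (fun b => 'I_(size (dl b))) i.
pose C : finType := {b : B & 'I_(size (dl b))}.
pose blk (b : B) : seq C := [seq tg b i | i <- enum 'I_(size (dl b))].
pose nu (c : C) := if tagged c == 0 :> nat then ext blk (mu (tag c)) else [::].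
pose f (c : C) := tnth (in_tuple (dl (tag c))) (tagged c).
have fblk s : map f (ext blk s) = ext dl s.
  rewrite /ext map_flatten -map_comp; congr flatten; apply: eq_map => b /=.
  by rewrite -map_comp; apply: (map_tnth_enum (in_tuple (dl b))).
have blk_head b :
    exists2 r, blk b = tg b (Ordinal (dl0 b)) :: r & ext nu r = [::].
  have [r re r0] := enum_ord_head (dl0 b).
  exists (map (tg b) r); first by rewrite /blk re.
  elim: r r0 {re} => //= i r IH /andP[i0 /IH]; rewrite /ext /= => ->.
  by rewrite /nu /= gtn_eqF.
have blkN b : blk b <> [::] by have [r ->] := blk_head b.
(* This intertwining transfers the fixed point property and prolongability from x to the word made
   of the blocks of its letters. *)
have nuext s : ext nu (ext blk s) = ext blk (ext mu s).
  elim: s => // b s IH; rewrite -cat1s !ext_cat IH; congr (_ ++ _).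
  rewrite /ext /= !cats0; have [r -> r0] := blk_head b.
  by rewrite -cat1s -/(ext nu _) ext_cat r0 cats0 /ext /= cats0.
have blk_le s : size s <= size (ext blk s).
  elim: s => // b s IH; rewrite -cat1s ext_cat !size_cat leq_add //.
  by rewrite /ext /= addn0 size_gt0.
have [y [yblk _]] : exists y, is_image blk x y by exact: is_image_exists.
exists C, nu, f, y; split.
- apply: is_image_cofinal => m.
  (* Large enough for both the prefix of x and its image under [mu] to have length at least [m]. *)
  have [n mn] := fx_unb m; pose k := n + m.
  have mk : m <= size (ext mu (mkseq x k)).
    by rewrite mkseq_add ext_cat size_cat (leq_trans mn) // leq_addr.
  have /= yk := yblk k; exists (size (ext blk (mkseq x k))).
  rewrite -yk nuext; split.
  + by rewrite (leq_trans _ (blk_le _)) // size_mkseq leq_addl.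
  + exact: leq_trans mk (blk_le _).
  + by rewrite fx; exact: yblk.
- have [r rE r0] := blk_head (x 0).
  have y0 : y 0 = tg (x 0) (Ordinal (dl0 (x 0))).
    have := yblk 1; rewrite /= /ext /= cats0 rE /= => /(congr1 (head (y 0))).
    by [].
  (* The first letter of [y] is sent to [blk (x 0) ++ ext blk v], whose tail this is; its iterates
     contain the blocks of the nonempty iterates of [v]. *)
  exists (r ++ ext blk v).
    by rewrite y0 /nu /= muv -cat1s ext_cat {1}/ext /= cats0 rE.
  move=> n; have -> : iter n (ext nu) (r ++ ext blk v) =
      iter n (ext nu) r ++ ext blk (iter n (ext mu) v).
    by elim: n => //= n ->; rewrite ext_cat nuext.
  move/(congr1 size); rewrite size_cat => /eqP; rewrite addn_eq0 => /andP[_].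
  by rewrite gtn_eqF // (leq_trans _ (blk_le _)) // size_gt0.
- move=> n; have [k nk] := dl_unb n.+1.
  have /= E := dw k; have := congr1 (map f) (yblk k).
  rewrite /= fblk E -(size_map f (ext blk _)) fblk.
  rewrite /mkseq -map_comp => /(congr1 (nth (w n) ^~ n)).
  by rewrite !(nth_map 0) ?size_iota // nth_iota.
Qed.

(** [morphic] asks for a finite type, so the letter j is coded by the ordinal j - 1; closure of the
    alphabet under [mu] makes the coding compatible with [mu]. *)
Lemma morphic_image_nat (m : nat) (mu dl : nat -> seq nat) (x w : nat -> nat) :
  let P := [pred j | 1 <= j <= m.+1] in
  (forall n, P (x n)) -> morphism_on P mu ->
  (forall j, P j -> mu j <> [::]) -> (forall j, P j -> dl j <> [::]) ->
  (exists2 u, mu (x 0) = x 0 :: u & u <> [::]) ->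
  fixed_point mu x -> is_image dl x w -> morphic w.
Proof.
move=> P xP muP muN dN [u mu0 uN] [fx fx_unb] [dw d_unb].
pose h (a : nat) : 'I_m.+1 := inord a.-1.
have hK j : P j -> (h j).+1 = j.
  by case: j => // j /andP[_ jm]; rewrite /h inordK.
have PS (b : 'I_m.+1) : P b.+1 by rewrite /= ltn_ord.
pose mu' (b : 'I_m.+1) := map h (mu b.+1).
pose dl' (b : 'I_m.+1) := dl b.+1.
have extmu s : all P s -> ext mu' (map h s) = map h (ext mu s).
  move=> /allP sP; rewrite /ext map_flatten -!map_comp; congr flatten.
  by apply/eq_in_map => j /sP jP; rewrite /= /mu' hK.
have extdl s : all P s -> ext dl' (map h s) = ext dl s.
  move=> /allP sP; rewrite /ext -!map_comp; congr flatten.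
  by apply/eq_in_map => j /sP jP; rewrite /= /dl' hK.
have xsP n : all P (mkseq x n) by rewrite all_map; apply/allP => i _; exact: xP.
have hx n : mkseq (h \o x) n = map h (mkseq x n) by rewrite /mkseq map_comp.
apply: (@morphic_image _ _ mu' dl' (h \o x)).
- split=> [n /=|k]; last first.
    by have [n kn] := fx_unb k; exists n; rewrite hx extmu // size_map.
  by rewrite hx extmu // {1}fx size_map hx.
- exists (map h u); first by rewrite /mu' /= hK // mu0.
  move=> n; elim: n => [|n IH] /=; first by case: (u) uN.
  case: (iter _ _ _) IH => // b s _; rewrite /ext /=.
  by have := muN _ (PS b); rewrite /mu'; case: (mu _).
- by move=> b; exact: dN.
- split=> [n /=|k]; last first.
    by have [n kn] := d_unb k; exists n; rewrite hx extdl.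
  by rewrite hx extdl.
Qed.

(** * Floors of multiples of beta *)

Definition beta (R : realType) (t : nat) : R := (alpha R t - 1)%R.

Lemma beta_gt0 (R : realType) (t : nat) : (0 < beta R t)%R.
Proof.
have : (t%:R < Num.sqrt (t%:R ^+ 2 + 4) :> R)%R.
  have t0 : (0 <= t%:R :> R)%R by [].
  rewrite -[X in (X < _)%R](ger0_norm t0) -sqrtr_sqr ltr_sqrt; first by lra.
  by rewrite ltr_wpDl ?sqr_ge0.
by rewrite /beta /alpha; lra.
Qed.

(** beta is the positive root of b^2 + t b = 1; the later arithmetic rests on this equation. *)
Lemma betaE (R : realType) (t : nat) : (t%:R * beta R t = 1 - beta R t ^+ 2)%R.
Proof.
have := @sqr_sqrtr R (t%:R ^+ 2 + 4)%R.
rewrite addr_ge0 ?sqr_ge0 // => /(_ isT).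
set s := Num.sqrt _ => h; have sE : s = (2 * beta R t + t%:R)%R.
  by rewrite /beta /alpha -/s; lra.
by rewrite sE in h; nra.
Qed.

Lemma beta_bounds (R : realType) (t : nat) :
  2 <= t -> (0 < beta R t)%R /\ (2 * beta R t < 1)%R.
Proof.
move=> ht; have b0 := beta_gt0 R t; split=> //.
have t2 : (2 <= t%:R :> R)%R by rewrite (ler_nat R 2).
by have := betaE R t; nra.
Qed.

(* Infinite descent: if n beta = p then p beta = n - t p, and p < n. *)
Lemma beta_irrational (R : realType) (t n p : nat) :
  2 <= t -> 0 < n -> (n%:R * beta R t)%R <> (p%:R)%R.
Proof.
move=> ht; have [b0 b1] := beta_bounds R ht; have bE := betaE R t.
elim/ltn_ind: n p => n IH p n0 e.
have n0' : (0 < n%:R :> R)%R by rewrite ltr0n.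
have p0 : (0 < p)%N by rewrite -(ltr0n R) -e mulr_gt0.
have pn : (p < n)%N by rewrite -(ltr_nat R) -e; nra.
have e2 : (p%:R * beta R t = n%:R - t%:R * p%:R)%R.
  rewrite -e; transitivity (n%:R - n%:R * (t%:R * beta R t))%R; last by ring.
  by rewrite bE; ring.
have le : t * p <= n.
  rewrite -(ler_nat R) natrM -subr_ge0 -e2 mulr_ge0 //; exact: ltW.
by apply: (IH p pn (n - t * p) p0); rewrite e2 natrB // natrM.
Qed.

Definition floorb (R : realType) (t n : nat) : nat :=
  Num.truncn (n%:R * beta R t)%R.

(* The ceiling of {n beta} (t - 1 + beta), written as a floor plus 1; the two
   agree for n > 0 because beta is irrational. *)
Definition ceilb (R : realType) (t n : nat) : nat :=
  (Num.truncn
    ((n%:R * beta R t - (floorb R t n)%:R) * (t%:R - 1 + beta R t))%R).+1.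

Lemma floorbP (R : realType) (t n : nat) : 2 <= t -> 0 < n ->
  ((floorb R t n)%:R < n%:R * beta R t < (floorb R t n)%:R + 1)%R.
Proof.
move=> ht n0; rewrite lt_neqAle; apply/andP; split.
  rewrite truncn_le mulr_ge0 ?(ltW (beta_gt0 R t)) // andbT; apply/eqP=> e.
  exact: (beta_irrational ht n0 (esym e)).
by rewrite natr1 truncnS_gt.
Qed.

(** With k the floor of n beta, y = n + k - k t - (n + k) beta, so an integer y would make (n + k)
    beta an integer, against [beta_irrational]. *)
Lemma ceilbP (R : realType) (t n : nat)
    (y := ((n%:R * beta R t - (floorb R t n)%:R) * (t%:R - 1 + beta R t))%R) :
  2 <= t -> 0 < n -> ((ceilb R t n)%:R - 1 < y < (ceilb R t n)%:R)%R.
Proof.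
move=> ht n0; have [b0 b1] := beta_bounds R ht; have bE := betaE R t.
have t2 : (2 <= t%:R :> R)%R by rewrite (ler_nat R 2).
have /andP[f0 f1] := floorbP R ht n0.
have y0 : (0 < y)%R by apply: mulr_gt0; lra.
have -> : ((ceilb R t n)%:R - 1 = (ceilb R t n).-1%:R :> R)%R.
  by rewrite -natr1 addrK.
rewrite lt_neqAle.
rewrite truncn_le ltW // truncnS_gt !andbT; apply/eqP => e.
have yE : (y = n%:R + (floorb R t n)%:R - (floorb R t n)%:R * t%:R
               - (n + floorb R t n)%:R * beta R t)%R.
  transitivity (n%:R * (t%:R * beta R t) - n%:R * beta R t
    + n%:R * beta R t ^+ 2 - (floorb R t n)%:R * t%:R + (floorb R t n)%:R
    - (floorb R t n)%:R * beta R t)%R; first by rewrite /y; ring.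
  by rewrite bE natrD; ring.
set c := (ceilb R t n).-1.
have e2 : ((n + floorb R t n)%:R * beta R t =
           (n + floorb R t n)%:R - (floorb R t n * t + c)%:R)%R.
  rewrite -/y in e; rewrite !natrD natrM; rewrite natrD in yE.
  rewrite /c /ceilb -/y /= e; rewrite {1}yE.
  by ring.
have le : floorb R t n * t + c <= n + floorb R t n.
  by rewrite -(ler_nat R) -subr_ge0 -e2 mulr_ge0 // ltW.
rewrite -natrB // in e2.
by apply: (beta_irrational ht _ e2); rewrite addn_gt0 n0.
Qed.

Lemma floorb_eq (R : realType) (t n k : nat) :
  (k%:R <= n%:R * beta R t < k%:R + 1)%R -> floorb R t n = k.
Proof. by rewrite natr1; exact: truncn_def. Qed.

Lemma ceilb_eq (R : realType) (t n j : nat) :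
  (j%:R <= (n%:R * beta R t - (floorb R t n)%:R) * (t%:R - 1 + beta R t)
    < j%:R + 1)%R ->
  ceilb R t n = j.+1.
Proof. by rewrite natr1 => h; congr S; exact: truncn_def. Qed.

(** With k the floor and j the ceiling, A n = n + k and (n + k) beta = n + k - k t - y with j - 1 <
    y < j, whose floor is n + k - k t - j. Only additions appear, to avoid truncated subtraction. *)
Lemma AA_ceilb (R : realType) (t n : nat) : 2 <= t -> 0 < n ->
  A R t (A R t n) + floorb R t n * t + ceilb R t n = (n + floorb R t n).*2.
Proof.
move=> ht n0; have [b0 b1] := beta_bounds R ht; have bE := betaE R t.
have AE m : A R t m = m + floorb R t m.
  have -> : A R t m = Num.truncn (m%:R + m%:R * beta R t)%R.
    by congr Num.truncn; rewrite /beta; ring.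
  by rewrite truncnD ?natrK ?natr_nat // nnegrE mulr_ge0 // ltW.
rewrite !AE.
set k := floorb R t n; set j := ceilb R t n.
have := ceilbP R ht n0; rewrite -/k -/j; set y := (_ * _)%R => /andP[j0 j1].
have yE : ((n + k)%:R * beta R t = (n + k)%:R - k%:R * t%:R - y)%R.
  transitivity ((n + k)%:R + n%:R * (t%:R * beta R t) - n%:R
    + n%:R * beta R t ^+ 2  - k%:R * t%:R - y)%R; last by rewrite bE; ring.
  by rewrite /y natrD; ring.
have le : (k * t + j <= n + k)%N.
  have : (0 <= (n + k)%:R * beta R t)%R by rewrite mulr_ge0 // ltW.
  rewrite -ltnS -(ltr_nat R) -natr1 yE !natrD natrM; lra.
suff -> : floorb R t (n + k) = n + k - (k * t + j) by lia.
apply: floorb_eq; rewrite yE natrB // [X in (_ - X)%R]natrD natrM; lra.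
Qed.

(* With f = {(n+1) beta} one has
   m beta = n + (1 - beta (t - 1 - i) - beta f), and the fractional part times
   t - 1 + beta equals i + beta (t - i - f (t - 1 + beta)). *)
Lemma block_interior (R : realType) (t n i : nat)
    (m := t * n + floorb R t n.+1 + 1 + i) :
  2 <= t -> i < t ->
  floorb R t m = n /\ ceilb R t m = i + (ceilb R t n.+1 <= t - i).
Proof.
move=> ht it; have [b0 b1] := beta_bounds R ht; have bE := betaE R t.
have bN0 : (beta R t != 0)%R by rewrite gt_eqF.
have t2 : (2 <= t%:R :> R)%R by rewrite (ler_nat R 2).
have it' : (i%:R + 1 <= t%:R :> R)%R by rewrite natr1 ler_nat.
have i0 : (0 <= i%:R :> R)%R by [].
have := floorbP R ht (ltn0Sn n); have := ceilbP R ht (ltn0Sn n).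
set k := floorb R t n.+1 in m *; set j := ceilb R t n.+1.
set b := beta R t in b0 b1 bE bN0 *.
set f := (n.+1%:R * b - k%:R)%R; set y := (f * _)%R.
move=> /andP[y0 y1] /andP[f0 f1].
have {}f0 : (0 < f)%R by rewrite /f; lra.
have {}f1 : (f < 1)%R by rewrite /f; lra.
(* Eliminating t leaves rational identities in b, which [field] proves. *)
have tE : (t%:R = b^-1 - b)%R.
  by apply: (mulIf bN0); rewrite bE; field.
have mE : (m%:R * b = n%:R + (1 - b * (t%:R - 1 - i%:R) - b * f))%R.
  by rewrite /m /f !natrD natrM -[in RHS]natr1 tE; field.
set F := (_ - b * f)%R in mE.
have F0 : (0 < F)%R.
  have -> : (F = b * (1 + i%:R - f) + b ^+ 2)%R by rewrite /F tE; field.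
  by rewrite addr_gt0 ?exprn_gt0 ?mulr_gt0 //; lra.
have F1 : (F < 1)%R by rewrite /F; nra.
have km : floorb R t m = n by apply: floorb_eq; rewrite -/b mE; lra.
split=> //.
have FE : (F * (t%:R - 1 + b) = i%:R + b * (t%:R - i%:R - y))%R.
  by rewrite /F /y tE; field.
have bt : (b * t%:R < 1)%R by rewrite mulrC bE; nra.
have yt : (y < t%:R)%R.
  by apply: (@lt_trans _ _ (t%:R - 1 + b)%R); [rewrite gtr_pMl; lra | lra].
(* As j - 1 < y < j, comparing j with the integer t - i gives the sign of t - i - y; and b (t - i -
   y) has absolute value below 1 since b t < 1. *)
have [jl|jl] := leqP j (t - i).
  have yl : (y < t%:R - i%:R)%R.
    by apply: lt_le_trans y1 _; rewrite -natrB ?ler_nat // ltnW.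
  rewrite addn1; apply: ceilb_eq; rewrite -/b km mE [(_ + F)%R]addrC addrK FE.
  have y0' : (0 < y)%R by rewrite mulr_gt0 //; lra.
  by apply/andP; split; nra.
have yl : (t%:R - i%:R < y)%R.
  apply: le_lt_trans y0; rewrite -(natrB _ (ltnW it)) lerBrDr natr1 ler_nat //.
have ipos : 0 < i by rewrite -(ltr_nat R); lra.
rewrite addn0 -(prednK ipos); apply: ceilb_eq; rewrite -/b km mE [(_ + F)%R]addrC addrK.
rewrite FE; have -> : (i.-1%:R = i%:R - 1 :> R)%R.
  by rewrite -[in RHS](prednK ipos) -natr1 addrK.
by apply/andP; split; nra.
Qed.

(* Here m beta = (n + 1) + beta (1 - f). *)
Lemma block_end (R : realType) (t n : nat) (m := t * n.+1 + floorb R t n.+1 + 1) :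
  2 <= t -> floorb R t m = n.+1 /\ ceilb R t m = 1.
Proof.
move=> ht; have [b0 b1] := beta_bounds R ht; have bE := betaE R t.
have bN0 : (beta R t != 0)%R by rewrite gt_eqF.
have t2 : (2 <= t%:R :> R)%R by rewrite (ler_nat R 2).
have := floorbP R ht (ltn0Sn n).
set k := floorb R t n.+1 in m *; set b := beta R t in b0 b1 bE bN0 *.
set f := (n.+1%:R * b - k%:R)%R => /andP[f0 f1].
have {}f0 : (0 < f)%R by rewrite /f; lra.
have {}f1 : (f < 1)%R by rewrite /f; lra.
have tE : (t%:R = b^-1 - b)%R.
  by apply: (mulIf bN0); rewrite bE; field.
have mE : (m%:R * b = n.+1%:R + b * (1 - f))%R.
  by rewrite /m /f !natrD natrM tE; field.
have km : floorb R t m = n.+1 by apply: floorb_eq; rewrite -/b mE; nra.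
split=> //; apply: ceilb_eq; rewrite -/b km mE [(_ + b * _)%R]addrC addrK.
have -> : (b * (1 - f) * (t%:R - 1 + b) = (1 - b) * (1 - f))%R.
  by rewrite tE; field.
by nra.
Qed.

Lemma ceilb_le (R : realType) (t n : nat) : 2 <= t -> ceilb R t n.+1 <= t.
Proof.
move=> ht; have [b0 b1] := beta_bounds R ht.
have t2 : (2 <= t%:R :> R)%R by rewrite (ler_nat R 2).
have /andP[f0 f1] := floorbP R ht (ltn0Sn n).
have /andP[y0 _] := ceilbP R ht (ltn0Sn n).
rewrite -ltnS -(ltr_nat R) -[X in (_ < X)%R]natr1 -ltrBlDr; apply: lt_trans y0 _.
by apply: (@lt_trans _ _ (t%:R - 1 + beta R t)%R); [rewrite gtr_pMl; lra | lra].
Qed.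

(** The floor jumps when f >= 1 - beta, where f is the fractional part. The threshold (1 - beta) (t
    - 1 + beta) = t - 2 + 2 beta lies strictly between t - 2 and t - 1, so only the ceiling t - 1
    leaves the jump undecided; hence the extra letter t + 1. *)
Lemma floorb_step (R : realType) (t n : nat) : 2 <= t ->
  (floorb R t n.+2 = floorb R t n.+1 /\ ceilb R t n.+1 < t) \/
  (floorb R t n.+2 = (floorb R t n.+1).+1 /\ t.-1 <= ceilb R t n.+1).
Proof.
move=> ht; have [b0 b1] := beta_bounds R ht; have bE := betaE R t.
have t2 : (2 <= t%:R :> R)%R by rewrite (ler_nat R 2).
have /andP[f0 f1] := floorbP R ht (ltn0Sn n).
have /andP[y0 y1] := ceilbP R ht (ltn0Sn n).
set b := beta R t in b0 b1 bE f0 f1 y0 y1 *.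
set k := floorb R t n.+1 in f0 f1 y0 y1 *.
set j := ceilb R t n.+1 in y0 y1 *.
set f := (n.+1%:R * b - k%:R)%R in y0 y1.
have r : ((1 - b) * (t%:R - 1 + b) = t%:R - 2 + 2 * b)%R by nra.
have [h|h] := ltP (f + b)%R 1%R; [left | right]; split.
- by apply: floorb_eq; rewrite -/b -natr1; move: h; rewrite /f; lra.
- rewrite -(ltr_nat R).
  have : (f * (t%:R - 1 + b) < (1 - b) * (t%:R - 1 + b))%R.
    by rewrite ltr_pM2r; lra.
  by rewrite r; lra.
- by apply: floorb_eq; rewrite -/b -[X in (X * b)%R]natr1
    -[in X in (X <= _)%R]natr1 -[in X in (_ < X)%R]natr1; move: h; rewrite /f; lra.
- have : ((1 - b) * (t%:R - 1 + b) <= f * (t%:R - 1 + b))%R.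
    by rewrite ler_pM2r; lra.
  rewrite r -ltnS -ltnS prednK ?(ltn_trans _ ht) // => h2.
  by rewrite -(ltr_nat R) -[X in (_ < X)%R]natr1 -[X in (_ < X + _)%R]natr1; lra.
Qed.

(** * The words tau and delta *)

(* The letters with images of length t + 1 are t and t + 1 (b = 1); otherwise
   t + 1 behaves like t - 1, with which it shares the rank j. *)
Definition tau_block (t j b : nat) : seq nat :=
  mkseq (fun i => if i < t.-1 then i + (j <= t - i)
                  else if j == 1 then t else t.+1) t ++ nseq b 1.

(** By [AA_ceilb] a difference is 2 + g_m - g_(m+1), plus 2 - t when the floor jumps. With g_m = i +
    [j <= t - i] this is 1 + [j = t - i] inside a block and 2 + [j = 1] at the jump. *)
Definition delta_block (t j b : nat) : seq nat :=
  mkseq (fun i => if i < t.-1 then 1 + (j == t - i) else 2 + (j == 1)) t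
    ++ nseq b 2.

Definition letter_rank (t a : nat) : nat := if a == t.+1 then t.-1 else a.

(** With the default 0 made explicit, this and the next two lemmas turn letters of words into
    piecewise linear functions of the position, which [word_eq] splits into cases for [lia]. *)
Lemma nth_iota_if (m n i : nat) :
  nth 0 (iota m n) i = if i < n then m + i else 0.
Proof. by case: ltnP => h; [rewrite nth_iota | rewrite nth_default ?size_iota]. Qed.

Lemma nth_mkseq_if (f : nat -> nat) (n i : nat) :
  nth 0 (mkseq f n) i = if i < n then f i else 0.
Proof. by case: ltnP => h; [rewrite nth_mkseq | rewrite nth_default ?size_mkseq]. Qed.

Lemma nth_cons_if (a i : nat) (s : seq nat) :
  nth 0 (a :: s) i = if i == 0 then a else nth 0 s i.-1.
Proof. by case: i. Qed.

Ltac word_eq :=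
  apply: (@eq_from_nth _ 0) => [|i _];
  rewrite /consec ?(size_cat, size_iota, size_nseq, size_mkseq, size_rcons) /=;
  [ lia | rewrite !(nth_cat, size_cat, size_iota, size_nseq, size_mkseq,
      nth_iota_if, nth_mkseq_if, nth_nseq, nth_cons_if) ?nth_nil /=;
  repeat (case: ifP => ?); lia ].

(** Merges the tables for t = 2, t = 3 and t >= 4, so that the orbit is treated uniformly in t. *)
Lemma tauE (t a : nat) : 2 <= t -> alphabet t a ->
  tau t a = tau_block t (letter_rank t a) (t <= a).
Proof.
move=> ht /andP[a1 at1].
have [t2|t2] := eqVneq t 2.
  by rewrite t2 in at1 *; case: a a1 at1 => [|[|[|[|]]]].
have [t3|t3] := eqVneq t 3.
  by rewrite t3 in at1 *; case: a a1 at1 => [|[|[|[|[|]]]]].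
rewrite /tau (negPf t2) (negPf t3) /tau_ge4 /letter_rank.
case: ifP => [/eqP ->|a_1].
  have -> : (1 == t.+1) = false by lia.
  have -> : (t <= 1) = false by lia.
  by rewrite /tau_block; word_eq.
case: ifP => [/eqP ->|a_2].
  have -> : (2 == t.+1) = false by lia.
  have -> : (t <= 2) = false by lia.
  by rewrite /tau_block; word_eq.
case: ifP => [a_3|a_3].
  have -> : (a == t.+1) = false by lia.
  have -> : (t <= a) = false by lia.
  by rewrite /tau_block; word_eq.
case: ifP => [/eqP ->|a_4].
  have -> : (t == t.+1) = false by lia.
  by rewrite leqnn /tau_block; word_eq.
have -> : a = t.+1 by lia.
by rewrite addn1 !eqxx leqnSn /tau_block; word_eq.
Qed.

Lemma deltaE (t a : nat) : 2 <= t -> alphabet t a ->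
  delta t a = delta_block t (letter_rank t a) (t <= a).
Proof.
move=> ht /andP[a1 at1].
have [t2|t2] := eqVneq t 2.
  by rewrite t2 in at1 *; case: a a1 at1 => [|[|[|[|]]]].
have [t3|t3] := eqVneq t 3.
  by rewrite t3 in at1 *; case: a a1 at1 => [|[|[|[|[|]]]]].
rewrite /delta (negPf t2) (negPf t3) /delta_ge4 /letter_rank.
case: ifP => [/eqP ->|a_1].
  have -> : (1 == t.+1) = false by lia.
  have -> : (t <= 1) = false by lia.
  by rewrite /delta_block; word_eq.
case: ifP => [/eqP ->|a_2].
  have -> : (2 == t.+1) = false by lia.
  have -> : (t <= 2) = false by lia.
  by rewrite /delta_block; word_eq.
case: ifP => [a_3|a_3].
  have -> : (a == t.+1) = false by lia.
  have -> : (t <= a) = false by lia.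
  by rewrite /delta_block; word_eq.
case: ifP => [/eqP ->|a_4].
  have -> : (t == t.+1) = false by lia.
  by rewrite leqnn /delta_block; word_eq.
have -> : a = t.+1 by lia.
by rewrite addn1 !eqxx leqnSn /delta_block; word_eq.
Qed.

Lemma tau_alphabet (t : nat) : 2 <= t -> morphism_on (alphabet t) (tau t).
Proof.
move=> ht a aP; rewrite tauE // all_cat all_map /alphabet; move: aP => /andP[a1 at1].
apply/andP; split; last by apply/allP => i /nseqP[-> _] /=; lia.
by apply/allP => i; rewrite mem_iota /letter_rank /= => it; repeat (case: ifP => ?); lia.
Qed.

Lemma delta_alphabet (t : nat) : 2 <= t -> morphism_on (alphabet t) (delta t).
Proof.
move=> ht a aP; rewrite deltaE // all_cat all_map /alphabet; move: aP => /andP[a1 at1].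
apply/andP; split; last by apply/allP => i /nseqP[-> _] /=; lia.
by apply/allP => i; rewrite mem_iota /letter_rank /= => it; repeat (case: ifP => ?); lia.
Qed.

(** * The coding of the orbit of beta *)

(** For n >= 1 the condition {n beta} > 1 - beta is expressed by a jump of the floor from n to n +
    1; by [floorb_step] the ceiling is then t - 1 or t. *)
Definition letter (R : realType) (t n : nat) : nat :=
  if floorb R t n.+1 == floorb R t n then ceilb R t n
  else if ceilb R t n == t then t else t.+1.

(** The last clause makes the lengths of the images agree with the block boundaries t n +
    k_(n+1). *)
Lemma letter_spec (R : realType) (t n : nat) : 2 <= t ->
  [/\ alphabet t (letter R t n.+1),
      letter_rank t (letter R t n.+1) = ceilb R t n.+1 &
      floorb R t n.+2 = floorb R t n.+1 + (t <= letter R t n.+1)].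
Proof.
move=> ht; have le := ceilb_le R n ht.
have gt0 : 0 < ceilb R t n.+1 by [].
rewrite /letter /letter_rank /alphabet /=.
case: (floorb_step R n ht) => -[-> h].
  by rewrite eqxx; split; repeat (case: ifP => ?); lia.
have -> : ((floorb R t n.+1).+1 == floorb R t n.+1) = false by lia.
by case: ifP => /eqP h2; split; repeat (case: ifP => ?); lia.
Qed.

Lemma tau_letter (R : realType) (t n : nat) (a := letter R t n.+1) : 2 <= t ->
  tau t a =
    mkseq (fun i => letter R t (t * n + floorb R t n.+1 + 1 + i)) (t + (t <= a)).
Proof.
move=> ht; have [aP ra fa] := letter_spec R n ht; have le := ceilb_le R n ht.
have gt0 : 0 < ceilb R t n.+1 by [].
rewrite tauE // /a ra /tau_block mkseq_add.
have mS i : (t * n + floorb R t n.+1 + 1 + i).+1 =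
    t * n + floorb R t n.+1 + 1 + i.+1 by lia.
have [fe ce1] := block_end R n ht.
have mE : t * n.+1 + floorb R t n.+1 + 1 =
    t * n + floorb R t n.+1 + 1 + t by lia.
rewrite mE in fe ce1.
congr (_ ++ _).
  apply/eq_in_map => i; rewrite mem_iota add0n => /= it; rewrite /letter mS.
  have [-> ->] := block_interior R n ht it.
  have [it1|it1] := ltnP i t.-1.
    have [|-> _] := @block_interior R t n i.+1 ht; first by lia.
    by rewrite eqxx.
  (* At the last regular place the floor jumps from n to n + 1, so the letter is t or t + 1. *)
  have -> : i.+1 = t by lia.
  rewrite fe; have -> : (n.+1 == n) = false by lia.
  by repeat (case: ifP => ?); lia.
(* The place after the extra one starts the next block, where the floor is still n + 1; so the extra
   letter is its ceiling, 1. *)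
case tle: (t <= _) => //=; rewrite /mkseq /= addn0 /letter ce1 fe.
have [|h _] := @block_interior R t n.+1 0 ht; first by lia.
rewrite fa tle /= in h.
have -> : (t * n + floorb R t n.+1 + 1 + t).+1 =
    t * n.+1 + (floorb R t n.+1 + 1) + 1 + 0 by lia.
by rewrite h eqxx.
Qed.

(** The offset is one less than in [tau_letter] because [DeltaAA] is indexed from 0 and [letter]
    from 1. *)
Lemma delta_letter (R : realType) (t n : nat) (a := letter R t n.+1) : 2 <= t ->
  delta t a =
    mkseq (fun i => DeltaAA R t (t * n + floorb R t n.+1 + i)) (t + (t <= a)).
Proof.
move=> ht; have [aP ra fa] := letter_spec R n ht; have le := ceilb_le R n ht.
have gt0 : 0 < ceilb R t n.+1 by [].
rewrite deltaE // /a ra /delta_block mkseq_add.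
have mS i : (t * n + floorb R t n.+1 + i).+1 =
    t * n + floorb R t n.+1 + 1 + i by lia.
have mSS i : (t * n + floorb R t n.+1 + i).+2 =
    t * n + floorb R t n.+1 + 1 + i.+1 by lia.
have [fe ce1] := block_end R n ht.
have mE : t * n.+1 + floorb R t n.+1 + 1 =
    t * n + floorb R t n.+1 + 1 + t by lia.
rewrite mE in fe ce1.
have D i : DeltaAA R t (t * n + floorb R t n.+1 + i) =
    A R t (A R t (t * n + floorb R t n.+1 + 1 + i.+1))
    - A R t (A R t (t * n + floorb R t n.+1 + 1 + i)).
  by rewrite /DeltaAA mSS mS.
have AA i := @AA_ceilb R t (t * n + floorb R t n.+1 + 1 + i) ht.
congr (_ ++ _).
  apply/eq_in_map => i; rewrite mem_iota add0n => /= it; rewrite D.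
  have := AA i; have := AA i.+1.
  have [-> ->] := block_interior R n ht it.
  have [it1|it1] := ltnP i t.-1.
    have [|-> ->] := @block_interior R t n i.+1 ht; first by lia.
    by lia.
  have -> : i.+1 = t by lia.
  rewrite fe ce1 mulSn.
  by lia.
case tle: (t <= _) => //=; rewrite /mkseq /= D.
have [|h1 h2] := @block_interior R t n.+1 0 ht; first by lia.
rewrite fa tle /= in h1 h2.
have e : t * n + floorb R t n.+1 + 1 + t.+1 =
    t * n.+1 + (floorb R t n.+1 + 1) + 1 + 0 by lia.
rewrite addn0; have := AA t; have := AA t.+1.
rewrite e h1 h2 fe ce1 -e.
(* This bound makes the ceiling at the first place of the next block equal to 1, so the extra
   difference is 2. *)
have := ceilb_le R n.+1 ht.
by move=> c_le AA1 AA0; congr cons; lia.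
Qed.

Theorem theorem2 (R : realType) (t : nat) (ht : 2 <= t) :
  morphic (DeltaAA R t) /\
  [/\ morphism_on (alphabet t) (tau t),
      morphism_on (alphabet t) (delta t) &
      exists x : nat -> nat,
        [/\ forall n, alphabet t (x n),
            fixed_point (tau t) x &
            is_image (delta t) x (DeltaAA R t)]].
Proof.
pose x n := letter R t n.+1; pose pos n := t * n + floorb R t n.+1.
have xP n : alphabet t (x n) by have [] := letter_spec R n ht.
have [fl1 ce1] : floorb R t 1 = 0 /\ ceilb R t 1 = 1.
  have [b0 b1] := beta_bounds R ht.
  have f1 : floorb R t 1 = 0 by apply: floorb_eq; lra.
  (* The first place of the first block is 1 itself, so the formula reads g_1 = [g_1 <= t]. *)
  have [|_] := @block_interior R t 0 0 ht; first by lia.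
  by rewrite muln0 f1 !addn0 !add0n subn0 ceilb_le.
have x0 : x 0 = 1.
  have fl2 : floorb R t 2 = 0.
    by have [b0 b1] := beta_bounds R ht; apply: floorb_eq; lra.
  by rewrite /x /letter fl2 fl1.
have sz_tau j : alphabet t j -> size (tau t j) = t + (t <= j).
  by move=> jP; rewrite tauE // size_cat size_mkseq size_nseq.
have sz_delta j : alphabet t j -> size (delta t j) = t + (t <= j).
  by move=> jP; rewrite deltaE // size_cat size_mkseq size_nseq.
have tauN j : alphabet t j -> tau t j <> [::].
  by move=> /sz_tau e; move: e ht => + + h; rewrite h /=; lia.
have deltaN j : alphabet t j -> delta t j <> [::].
  by move=> /sz_delta e; move: e ht => + + h; rewrite h /=; lia.
have pos0 : pos 0 = 0 by rewrite /pos fl1 muln0.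
have posS n : pos n.+1 = pos n + (t + (t <= x n)).
  by rewrite /pos; have [_ _ ->] := letter_spec R n ht; rewrite -/(x n); lia.
have fx : fixed_point (tau t) x.
  apply: (is_image_blocks pos0) => n; rewrite ?sz_tau //; first exact: tauN.
  rewrite tau_letter //; apply: eq_mkseq => i.
  by rewrite /x /pos addn1 addSn.
have dx : is_image (delta t) x (DeltaAA R t).
  apply: (is_image_blocks pos0) => n; rewrite ?sz_delta //; first exact: deltaN.
  by rewrite delta_letter.
have tau_dec := tau_alphabet ht; have delta_dec := delta_alphabet ht.
split; last by split=> //; exists x.
apply: (@morphic_image_nat t (tau t) (delta t) x) => //.
(* Prolongability comes from the fixed point property: the image of the first letter is a prefix of
   x, of length at least t >= 2. *)
have [/(_ 1) /= + _] := fx; rewrite /ext /= cats0 sz_tau // => ->.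
move: ht; case: (t) => [|[|s]] // _.
by exists (map x (iota 1 (s.+1 + (s.+2 <= x 0)))).
Qed.
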